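(* Let $G>0$, $\epsilon>0$, $k\ge3$, and let $\ell_1,\dots,\ell_T$ and $\hat\ell_1,\dots,\hat\ell_T$ be $G$-Lipschitz convex functions $\mathbb{R}^d\to\mathbb{R}$. Run the Implicit-Optimistic Centered Mirror Descent algorithm of the context with $$\psi_t(w)=k\int_0^{\|w\|}\min_{0<\eta\le\frac1{2G}}\left[\frac{\log(x/\widehat\alpha_t+1)}{\eta}+\eta\widehat V_t\right]dx,$$ where $$\widehat V_t=16G^2+\sum_{s=1}^{t-1}\|g_s-h_s\|^2,\qquad \widehat\alpha_t=\frac{\epsilon G}{\sqrt{\widehat V_t}\,\log^2(\widehat V_t/G^2)},$$ with $g_s\in\partial\ell_s(w_s)$ and $h_s\in\partial\hat\ell_s(w_s)$ as in the context. Then for all $u\in\mathbb{R}^d$, $$\sum_{t=1}^T\big(\ell_t(w_t)-\ell_t(u)\big)\le4\epsilon G+2k\|u\|\max\left\{\sqrt{\widehat V_{T+1}\log\left(\frac{\|u\|}{\widehat\alpha_{T+1}}+1\right)},\ 2G\log\left(\frac{\|u\|}{\widehat\alpha_{T+1}}+1\right)\right\}.$$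
   Context: $\|\cdot\|$ is the Euclidean norm, $\log$ the natural logarithm. For differentiable $\psi$, $D_\psi(x|y)=\psi(x)-\psi(y)-\langle\nabla\psi(y),x-y\rangle$. The minimum over $\eta$ in the integrand is an infimum (equal to $0$) at $x=0$. Implicit-Optimistic Centered Mirror Descent: $x_1=\arg\min_x\psi_1(x)$ (here $x_1=0$) and $w_1=\arg\min_w\hat\ell_1(w)+D_{\psi_1}(w|x_1)$. In each round $t=1,\dots,T$: play $w_t$, observe $\ell_t$, take any $g_t\in\partial\ell_t(w_t)$; a regularizer $\psi_{t+1}$ and a guess $\hat\ell_{t+1}$ of the next loss are chosen (based on the past); with $\Delta_t(w)=D_{\psi_{t+1}}(w|x_1)-D_{\psi_t}(w|x_1)$, update $$x_{t+1}=\arg\min_x\ \langle g_t,x\rangle+D_{\psi_t}(x|x_t)+\Delta_t(x),\qquad w_{t+1}=\arg\min_w\ \hat\ell_{t+1}(w)+D_{\psi_{t+1}}(w|x_{t+1}).$$ $h_t\in\partial\hat\ell_t(w_t)$ denotes the subgradient for which the first-order optimality condition $h_t+\nabla\psi_t(w_t)-\nabla\psi_t(x_t)=0$ of the definition of $w_t$ holds. *)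

(* Defs.v *)
From HB Require Import structures.
From mathcomp Require Import all_boot all_order all_algebra.
From mathcomp Require Import all_classical all_reals all_analysis.

Set Implicit Arguments.
Unset Strict Implicit.
Unset Printing Implicit Defensive.

Import Order.TTheory GRing.Theory Num.Theory.
Import numFieldNormedType.Exports.

Local Open Scope classical_set_scope.
Local Open Scope ring_scope.

(* Vectors of R^d are row vectors. The library norm [`|x|] on ['rV[R]_d] is the
   sup norm, so the Euclidean norm is defined separately; the topology, hence
   differentiability, is the same for both. *)

Definition dotp (R : realType) (d : nat) (x y : 'rV[R]_d) : R :=
  \sum_(i < d) x 0 i * y 0 i.

Definition enorm (R : realType) (d : nat) (x : 'rV[R]_d) : R :=
  Num.sqrt (dotp x x).

(* The row vector of partial derivatives; meaningful where [f] is
   differentiable. *)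
Definition gradient (R : realType) (d : nat) (f : 'rV[R]_d -> R)
    (y : 'rV[R]_d) : 'rV[R]_d :=
  \row_(i < d) 'D_(delta_mx 0 i) f y.

Definition bregman (R : realType) (d : nat) (psi : 'rV[R]_d -> R)
    (x y : 'rV[R]_d) : R :=
  psi x - psi y - dotp (gradient psi y) (x - y).

Definition elipschitz (R : realType) (d : nat) (G : R) (f : 'rV[R]_d -> R) :
    Prop :=
  forall x y : 'rV[R]_d, `|f x - f y| <= G * enorm (x - y).

Definition subdifferential (R : realType) (d : nat) (f : 'rV[R]_d -> R)
    (x : 'rV[R]_d) : set 'rV[R]_d :=
  [set g | forall y : 'rV[R]_d, f x + dotp g (y - x) <= f y].

Definition argmin (R : realType) (d : nat) (f : 'rV[R]_d -> R) :
    set 'rV[R]_d :=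
  [set x | forall y : 'rV[R]_d, f x <= f y].

(* Rounds are numbered 1, ..., T; index 0 of every sequence is unused, as are
   the values of [w], [g], [h], [ell], [ellhat] beyond index T and those of [x],
   [psi] beyond index T + 1. *)
Record iocmd (R : realType) (d T : nat)
    (ell ellhat psi : nat -> 'rV[R]_d -> R) (x w g h : nat -> 'rV[R]_d) :
    Prop := IOCMD {
  iocmd_init : argmin (psi 1%N) (x 1%N) ;
  iocmd_play : forall t, (1 <= t <= T)%N ->
    argmin (fun v => ellhat t v + bregman (psi t) v (x t)) (w t) ;
  iocmd_subgrad : forall t, (1 <= t <= T)%N ->
    subdifferential (ell t) (w t) (g t) ;
  iocmd_update : forall t, (1 <= t <= T)%N ->
    argmin (fun v => dotp (g t) v + bregman (psi t) v (x t)
                     + (bregman (psi t.+1) v (x 1%N)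
                        - bregman (psi t) v (x 1%N)))
           (x t.+1) ;
  iocmd_hint : forall t, (1 <= t <= T)%N ->
    subdifferential (ellhat t) (w t) (h t) ;
  iocmd_optimality : forall t, (1 <= t <= T)%N ->
    h t + gradient (psi t) (w t) - gradient (psi t) (x t) = 0
}.

Definition Vhat (R : realType) (d : nat) (G : R) (g h : nat -> 'rV[R]_d)
    (t : nat) : R :=
  16 * G ^+ 2 + \sum_(1 <= s < t) enorm (g s - h s) ^+ 2.

Definition alphahat (R : realType) (d : nat) (eps G : R)
    (g h : nat -> 'rV[R]_d) (t : nat) : R :=
  eps * G / (Num.sqrt (Vhat G g h t) * ln (Vhat G g h t / G ^+ 2) ^+ 2).

(* The infimum is a minimum for [0 < r]; it is 0 and not attained at [r = 0]. *)
Definition reg_slope (R : realType) (G V alpha r : R) : R :=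
  inf [set ln (r / alpha + 1) / eta + eta * V |
       eta in [set eta : R | 0 < eta <= (2 * G)^-1]].

Definition regularizer (R : realType) (d : nat) (k eps G : R)
    (g h : nat -> 'rV[R]_d) (t : nat) (w : 'rV[R]_d) : R :=
  k * \int[lebesgue_measure]_(r in `[0, enorm w])
        reg_slope G (Vhat G g h t) (alphahat eps G g h t) r.

(* Main.v *)
(* With x_1 = 0 the optimality conditions telescope to
   grad psi_t(x_t) = - (g_1 + ... + g_(t-1)), so the algorithm is
   follow-the-regularized-leader with hints: x_t minimizes
   <g_1 + ... + g_(t-1), v> + psi_t(v).  Telescoping the minimal values M_t bounds
   the regret by psi_(T+1)(u) + sum_t (<g_t, w_t> + M_t - M_(t+1)), and
   psi_(T+1)(u) gives the main term.  Writing psi_t(v) = k Phi_t(|v|),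
   a = |w_t|, b = |x_(t+1)|, c = |g_t - h_t|, each summand is at most
     c |w_t - x_(t+1)| - D_(psi_t)(x_(t+1) | w_t) - (psi_(t+1) - psi_t)(x_(t+1)).
   The slope F of Phi_t satisfies F' >= 1 / ((r + alpha) eta(r)), where eta(r) is the
   minimizing step size, which bounds the first two terms by
   c^2 (b + alpha) eta(3 b + 2 alpha) / 2.  Since F increases by at least c^2 eta from
   round t to t + 1, the third term absorbs this up to 4 c^2 alpha_t / sqrt V_t,
   and the logarithm in alpha_t makes these leftovers sum to at most 4 eps G. *)
Require Import Defs.
From mathcomp Require Import all_boot all_order all_algebra.
From mathcomp Require Import all_classical all_reals all_analysis.
From mathcomp Require Import ring lra.
Import Order.TTheory GRing.Theory Num.Theory.
Import numFieldNormedType.Exports.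
Set Implicit Arguments.
Unset Strict Implicit.
Unset Printing Implicit Defensive.
Local Open Scope classical_set_scope.
Local Open Scope ring_scope.

(** * The radial profile of the regularizer and its slope *)

Definition radial (R : realType) (G V alpha r : R) : R :=
  \int[lebesgue_measure]_(s in `[0, r]) reg_slope G V alpha s.

Definition log_radius (R : realType) (alpha r : R) : R := ln (r / alpha + 1).

(* The minimizer in [reg_slope] for [0 < r]. *)
Definition rate (R : realType) (G V alpha r : R) : R :=
  Num.min (Num.sqrt (log_radius alpha r / V)) (2 * G)^-1.

Section Slope.
Context (R : realType) (G V alpha : R).
Hypotheses (G_gt0 : 0 < G) (V_gt0 : 0 < V) (alpha_gt0 : 0 < alpha).
Local Notation L := (log_radius alpha).
Local Notation eta := (rate G V alpha).
Local Notation F := (reg_slope G V alpha).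
Local Notation Phi := (radial G V alpha).
Implicit Types a b e r : R.

Lemma shift_gt0 r : 0 <= r -> 0 < r + alpha.
Proof. by move=> r_ge0; rewrite ltr_wpDl. Qed.

Lemma log_radius0 : L 0 = 0.
Proof. by rewrite /log_radius mul0r add0r ln1. Qed.

Lemma log_radius_ge0 r : 0 <= r -> 0 <= L r.
Proof.
by move=> r_ge0; rewrite ln_ge0 // lerDr divr_ge0 // ltW.
Qed.

Lemma log_radius_gt0 r : 0 < r -> 0 < L r.
Proof. by move=> r_gt0; rewrite ln_gt0 // ltrDr divr_gt0. Qed.

Lemma le_log_radius a b : 0 <= a -> a <= b -> L a <= L b.
Proof.
move=> a_ge0 ab.
have p_gt0 r : 0 <= r -> 0 < r / alpha + 1.
  by move=> r_ge0; rewrite ltr_wpDl // divr_ge0 // ltW.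
rewrite ler_ln ?posrE ?p_gt0 //; last exact: le_trans ab.
by rewrite lerD2r ler_pM2r ?invr_gt0.
Qed.

(** Concavity of the logarithm, as [ln q <= q - 1] at [q = (a + alpha) / (b + alpha)]. *)
Lemma log_radiusB_ge a b : 0 <= a -> a <= b ->
  (b - a) / (b + alpha) <= L b - L a.
Proof.
move=> a_ge0 ab; have b_ge0 : 0 <= b := le_trans a_ge0 ab.
have E r : r / alpha + 1 = (r + alpha) / alpha by field; rewrite gt_eqF.
have ap := shift_gt0 a_ge0; have bp := shift_gt0 b_ge0.
rewrite /log_radius !E !ln_div ?posrE // opprB addrA subrK.
have -> : (b - a) / (b + alpha) = - (((a + alpha) / (b + alpha)) - 1).
  by field; rewrite gt_eqF.
rewrite -[leRHS]opprB lerN2 -ln_div ?posrE //.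
have q : 0 < (a + alpha) / (b + alpha) by rewrite divr_gt0.
have := @le_ln1Dx R ((a + alpha) / (b + alpha) - 1).
have -> : 1 + ((a + alpha) / (b + alpha) - 1) = (a + alpha) / (b + alpha) by ring.
by apply; rewrite ltrBrDr addNr.
Qed.

Lemma rate0 : eta 0 = 0.
Proof.
rewrite /rate log_radius0 mul0r sqrtr0; apply/min_idPl.
by rewrite invr_ge0 mulr_ge0 // ltW.
Qed.

Lemma rate_gt0 r : 0 < r -> 0 < eta r.
Proof.
move=> r_gt0; rewrite lt_min sqrtr_gt0 divr_gt0 ?log_radius_gt0 //=.
by rewrite invr_gt0 mulr_gt0.
Qed.

Lemma rate_ge0 r : 0 <= eta r.
Proof. by rewrite le_min sqrtr_ge0 invr_ge0 mulr_ge0 // ltW. Qed.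

Lemma rate_le r : eta r <= (2 * G)^-1.
Proof. by rewrite ge_min lexx orbT. Qed.

Lemma le_rate a b : 0 <= a -> a <= b -> eta a <= eta b.
Proof.
move=> a_ge0 ab; rewrite le_min rate_le andbT ge_min ler_wsqrtr //.
by rewrite ler_pM2r ?invr_gt0 // le_log_radius.
Qed.

(* The difference of the two sides factors into two terms of equal sign. *)
Lemma rate_optimal r e : 0 < r -> 0 < e <= (2 * G)^-1 ->
  L r / eta r + eta r * V <= L r / e + e * V.
Proof.
move=> r_gt0 /andP[e_gt0 eG]; have n_gt0 := rate_gt0 r_gt0.
have l_gt0 := log_radius_gt0 r_gt0.
rewrite -subr_ge0.
have -> : L r / e + e * V - (L r / eta r + eta r * V) =
    (eta r - e) * (L r - e * eta r * V) / (e * eta r).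
  by field; rewrite !gt_eqF.
apply: divr_ge0; last by rewrite mulr_ge0 // ltW.
have sE : Num.sqrt (L r / V) ^+ 2 * V = L r.
  by rewrite sqr_sqrtr ?divrK ?unitfE ?gt_eqF // divr_ge0 // ltW.
have s_ge0 := sqrtr_ge0 (L r / V).
case: (lerP e (eta r)) => [le_e|lt_e].
  rewrite mulr_ge0 ?subr_ge0 // -sE ler_wpM2r ?(ltW V_gt0) // expr2.
  have ns : eta r <= Num.sqrt (L r / V) by rewrite ge_min lexx.
  by apply: ler_pM => //; [exact: ltW|exact: ltW|exact: le_trans ns].
(* The cap [(2 * G)^-1] is not the minimum here, because [eta r < e] while [e] respects the cap. *)
have nE : eta r = Num.sqrt (L r / V).
  apply/min_idPl; rewrite leNgt; apply/negP => s_gt.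
  by move: lt_e; rewrite /rate (min_idPr (ltW s_gt)) ltNge eG.
rewrite mulr_le0 // subr_le0 ?(ltW lt_e) // -[leLHS]sE -nE ler_wpM2r ?(ltW V_gt0) //.
by rewrite expr2 ler_wpM2r ?(ltW n_gt0) // ltW.
Qed.

Lemma step_value_ge0 r e : 0 <= r -> 0 < e -> 0 <= L r / e + e * V.
Proof.
move=> r_ge0 e_gt0; rewrite addr_ge0 // ?mulr_ge0 ?(ltW V_gt0) ?(ltW e_gt0) //.
  exact: log_radius_ge0.
by rewrite invr_ge0 ltW.
Qed.

Lemma reg_slope_le r e : 0 <= r -> 0 < e <= (2 * G)^-1 ->
  F r <= L r / e + e * V.
Proof.
move=> r_ge0 eP; apply: ge_inf; last by exists e.
exists 0 => _ [e' /andP[e'_gt0 _] <-].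
exact: step_value_ge0.
Qed.

Lemma reg_slope_ge0 r : 0 <= r -> 0 <= F r.
Proof.
move=> r_ge0; apply: lb_le_inf.
  by exists (L r / (2 * G)^-1 + (2 * G)^-1 * V), (2 * G)^-1 => //=;
    rewrite lexx invr_gt0 mulr_gt0.
move=> _ [e /andP[e_gt0 _] <-].
exact: step_value_ge0.
Qed.

(* At [r = 0] both sides are [0], on the right because [0 / 0 = 0]. *)
Lemma reg_slopeE r : 0 <= r -> F r = L r / eta r + eta r * V.
Proof.
rewrite le_eqVlt => /predU1P[<-|r_gt0].
  rewrite rate0 mul0r addr0 invr0 mulr0; apply/eqP; rewrite eq_le reg_slope_ge0 //.
  rewrite andbT; apply/ler_addgt0Pr => d d_gt0; rewrite add0r.
  (* At [r = 0] the logarithm vanishes, and a step size of at most [d / V] brings the remaining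
     [e * V] below [d]. *)
  have e_gt0 : 0 < Num.min (d / V) (2 * G)^-1.
    by rewrite lt_min divr_gt0 //= invr_gt0 mulr_gt0.
  have := @reg_slope_le 0 _ (lexx 0).
  move=> /(_ (Num.min (d / V) (2 * G)^-1)); rewrite log_radius0 mul0r add0r e_gt0.
  rewrite ge_min lexx orbT => /(_ isT) /le_trans; apply.
  by rewrite -ler_pdivlMr // ge_min lexx.
apply/le_anti/andP; split.
  by apply: reg_slope_le; [exact: ltW|rewrite rate_gt0 // rate_le].
apply: lb_le_inf; last by move=> _ [e eP <-]; exact: rate_optimal.
by exists (L r / eta r + eta r * V), (eta r) => //=; rewrite rate_le rate_gt0.
Qed.

Lemma reg_slope0 : F 0 = 0.
Proof. by rewrite reg_slopeE // rate0 mul0r invr0 mulr0 addr0. Qed.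

(* Only the logarithmic term changes when the step size is frozen at [b]. *)
Lemma reg_slopeB_ge a b : 0 <= a -> a <= b ->
  (b - a) / ((b + alpha) * eta b) <= F b - F a.
Proof.
move=> a_ge0 ab; have b_ge0 := le_trans a_ge0 ab.
move: (b_ge0); rewrite le_eqVlt => /predU1P[b0|b_gt0].
  have -> : a = b by apply/le_anti; rewrite ab -b0 a_ge0.
  by rewrite !subrr mul0r.
have n_gt0 := rate_gt0 b_gt0.
have Fa : F a <= L a / eta b + eta b * V.
  by apply: reg_slope_le; rewrite // n_gt0 rate_le.
rewrite (@reg_slopeE b) //.
apply: (@le_trans _ _ ((L b - L a) / eta b)); last by rewrite mulrBl; lra.
by rewrite invfM mulrA ler_pM2r ?invr_gt0 // log_radiusB_ge.
Qed.

Lemma le_reg_slope a b : 0 <= a -> a <= b -> F a <= F b.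
Proof.
move=> a_ge0 ab; rewrite -subr_ge0; apply: le_trans (reg_slopeB_ge a_ge0 ab).
rewrite divr_ge0 ?subr_ge0 // mulr_ge0 ?rate_ge0 // ltW //.
by rewrite shift_gt0 // (le_trans a_ge0).
Qed.

Lemma reg_slope_gt0 r : 0 < r -> 0 < F r.
Proof.
move=> r_gt0; have := reg_slopeB_ge (lexx 0) (ltW r_gt0).
rewrite reg_slope0 !subr0; apply: lt_le_trans.
by rewrite divr_gt0 // mulr_gt0 ?rate_gt0 // shift_gt0 // ltW.
Qed.

(** The increment bound from the origin, in product form so that it covers [r = 0]. *)
Lemma reg_slope_ge r : 0 <= r -> r <= F r * ((r + alpha) * eta r).
Proof.
rewrite le_eqVlt => /predU1P[<-|r_gt0]; first by rewrite reg_slope0 mul0r.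
have := reg_slopeB_ge (lexx 0) (ltW r_gt0).
by rewrite reg_slope0 !subr0 ler_pdivrMr // mulr_gt0 ?rate_gt0 // shift_gt0 // ltW.
Qed.

(** With an uncapped step size both terms of the slope equal [Num.sqrt (V * L r)]; with a capped
    one, [(2 * G)^-1 < s] makes the second term at most the first, [2 * G * L r]. *)
Lemma reg_slope_le_max r : 0 <= r ->
  F r <= 2 * Num.max (Num.sqrt (V * L r)) (2 * G * L r).
Proof.
rewrite le_eqVlt => /predU1P[<-|r_gt0].
  by rewrite reg_slope0 mulr_ge0 // le_max sqrtr_ge0.
have l_gt0 := log_radius_gt0 r_gt0.
rewrite reg_slopeE ?(ltW r_gt0) // /rate.
set M := Num.max _ _.
have Ml : Num.sqrt (V * L r) <= M by rewrite le_max lexx.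
have Mr : 2 * G * L r <= M by rewrite le_max lexx orbT.
set s := Num.sqrt (L r / V).
have s_gt0 : 0 < s by rewrite sqrtr_gt0 divr_gt0.
have sE : L r = s ^+ 2 * V.
  by rewrite sqr_sqrtr ?divrK ?unitfE ?gt_eqF // divr_ge0 // ltW.
have svE : Num.sqrt (V * L r) = s * V.
  have -> : V * L r = (s * V) ^+ 2 by rewrite sE; ring.
  by rewrite sqrtr_sqr ger0_norm // mulr_ge0 // ltW.
case: (lerP s (2 * G)^-1) => [_|s_gt].
  have -> : L r / s + s * V = 2 * (s * V) by rewrite sE; field; rewrite gt_eqF.
  by rewrite ler_pM2l // -svE.
have Gs : 1 < 2 * G * s.
  by rewrite mulrC -ltr_pdivrMr ?mul1r // mulr_gt0.
rewrite invrK; apply: (@le_trans _ _ (2 * (2 * G * L r))); last by rewrite ler_pM2l.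
have -> : 2 * (2 * G * L r) = L r * (2 * G) + L r * (2 * G) by ring.
rewrite lerD2l ler_pdivrMl ?mulr_gt0 //.
have -> : 2 * G * (L r * (2 * G)) = (2 * G * s) ^+ 2 * V by rewrite sE; ring.
by rewrite ler_peMl ?(ltW V_gt0) // expr_ge1 // ltW // (lt_trans _ Gs).
Qed.

(* Unlike [reg_slopeE], this closed form has no quotient vanishing at [r = 0]. *)
Definition slope_closed_form r : R :=
  let m := (L r + V / (2 * G) ^+ 2 - `|L r - V / (2 * G) ^+ 2|) / 2 in
  2 * Num.sqrt (V * m) + 2 * G * (L r - m).

(** Here [m] is the minimum of [L r] and the threshold [V / (2 * G) ^+ 2] at which the cap becomes
    active; the two branches of this minimum match those of [rate]. *)
Lemma reg_slope_closed_form r : 0 <= r -> F r = slope_closed_form r.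
Proof.
rewrite le_eqVlt => /predU1P[<-|r_gt0].
  rewrite reg_slope0 /slope_closed_form log_radius0 sub0r normrN ger0_norm.
    by rewrite add0r subrr mul0r mulr0 sqrtr0 !mulr0 subrr mulr0 addr0.
  by rewrite divr_ge0 ?exprn_ge0 ?mulr_ge0 // ltW.
have l_gt0 := log_radius_gt0 r_gt0.
rewrite reg_slopeE ?(ltW r_gt0) // /slope_closed_form -minr_absE /rate.
set s := Num.sqrt (L r / V).
have s_gt0 : 0 < s by rewrite sqrtr_gt0 divr_gt0.
have sE : L r = s ^+ 2 * V.
  by rewrite sqr_sqrtr ?divrK ?unitfE ?gt_eqF // divr_ge0 // ltW.
have i_gt0 : 0 < (2 * G)^-1 by rewrite invr_gt0 mulr_gt0.
have sqrtE z : 0 < z -> Num.sqrt (V * (z ^+ 2 * V)) = z * V.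
  move=> z_gt0; have -> : V * (z ^+ 2 * V) = (z * V) ^+ 2 by ring.
  by rewrite sqrtr_sqr ger0_norm // mulr_ge0 // ltW.
have -> : V / (2 * G) ^+ 2 = (2 * G)^-1 ^+ 2 * V by rewrite exprVn mulrC.
have G_neq0 : G != 0 by rewrite gt_eqF.
case: (lerP s (2 * G)^-1) => [s_le|s_gt].
  rewrite (min_idPl _); last first.
    by rewrite sE ler_pM2r // ler_pXn2r // nnegrE ltW.
  by rewrite sE sqrtE // subrr mulr0; field; rewrite gt_eqF.
rewrite (min_idPr _); last first.
  by rewrite sE ler_pM2r // ler_pXn2r ?nnegrE // ltW.
by rewrite sqrtE //; field.
Qed.

Lemma continuous_slope_closed_form r : 0 <= r ->
  {for r, continuous slope_closed_form}.
Proof.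
move=> r_ge0.
have cL : {for r, continuous L}.
  apply: continuous_comp; first by apply: cvgD; [exact: cvgMl|exact: cvg_cst].
  by apply: continuous_ln; rewrite ltr_wpDl // divr_ge0 // ltW.
pose m x := (L x + V / (2 * G) ^+ 2 - `|L x - V / (2 * G) ^+ 2|) / 2.
have cm : {for r, continuous m}.
  apply: cvgMl; apply: cvgB; first by apply: cvgD; [exact: cL|exact: cvg_cst].
  by apply: cvg_norm; apply: cvgB; [exact: cL|exact: cvg_cst].
apply: cvgD; apply: cvgMr; last by apply: cvgB; [exact: cL|exact: cm].
apply: (continuous_comp (f := fun x => V * m x)); first exact: cvgMr.
exact: sqrt_continuous.
Qed.

Lemma integrable_reg_slope r :
  lebesgue_measure.-integrable `[0, r] (EFin \o F).
Proof.
have mD : measurable (`[0, r] : set (measurableTypeR R)) by [].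
refine (@eq_integrable _ _ R lebesgue_measure _ mD (EFin \o slope_closed_form) _ _ _).
  by move=> x /[!inE] /= /[!in_itv] /= /andP[x_ge0 _]; rewrite reg_slope_closed_form.
apply: continuous_compact_integrable; first exact: segment_compact.
apply: continuous_in_subspaceT => x /[!inE] /= /[!in_itv] /= /andP[x_ge0 _].
exact: continuous_slope_closed_form.
Qed.

Lemma radial0 : Phi 0 = 0.
Proof. by rewrite /radial set_itv1 Rintegral_set1. Qed.

Lemma is_derive_radial r : 0 < r -> is_derive r 1 Phi (F r).
Proof.
(* Integrability up to [r + 1] makes [r] an interior point for the fundamental theorem. *)
move=> r_gt0; have r1 : r < r + 1 by rewrite ltrDl.
have [] := @continuous_FTC1_closed R F 0 r (r + 1) r1 (@integrable_reg_slope _) r_gt0.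
  have e : \forall x \near r, slope_closed_form x = F x.
    near=> x; rewrite reg_slope_closed_form //.
    by apply: ltW; near: x; exact: lt_nbhsr.
  rewrite /prop_for /continuous_at (reg_slope_closed_form (ltW r_gt0)).
  apply: cvg_trans (continuous_slope_closed_form (ltW r_gt0)).
  exact: near_eq_cvg.
by move=> dv <-; exact: (DeriveDef dv (esym (derive1E _ _))).
Unshelve. all: by end_near.
Qed.

(** Allows mean value arguments on intervals starting at [0], where [is_derive_radial] does not
    apply. *)
Lemma continuous_radial a b : 0 <= a -> {within `[a, b], continuous Phi}.
Proof.
move=> a_ge0; have [ab|ba] := lerP 0 b; last first.
  rewrite set_itv_ge; first exact: continuous_subspace0.
  by rewrite bnd_simp -ltNge (lt_le_trans ba).
apply: (@continuous_subspaceW _ _ _ `[0, b]).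
  by apply: subset_itvr; rewrite bnd_simp.
exact: parameterized_integral_continuous (@integrable_reg_slope b).
Qed.

End Slope.

(** * Convexity of the profile and stability of one round *)

Section RadialBounds.
Context (R : realType) (G V alpha : R).
Hypotheses (G_gt0 : 0 < G) (V_gt0 : 0 < V) (alpha_gt0 : 0 < alpha).
Local Notation L := (log_radius alpha).
Local Notation eta := (rate G V alpha).
Local Notation F := (reg_slope G V alpha).
Local Notation Phi := (radial G V alpha).
Implicit Types a b c k m r rho y z : R.

(** The comparison function [f] will be a tangent line or a tangent parabola of [Phi]. *)
Lemma radial_mvt (f df : R -> R) a b : 0 <= a -> a <= b ->
  (forall r, is_derive r 1 f (df r)) ->
  exists2 r, a <= r <= b &
    (Phi b - f b) - (Phi a - f a) = (F r - df r) * (b - a).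
Proof.
move=> a_ge0 ab fdf.
have [||r] := @MVT_segment R (fun r => Phi r - f r) (fun r => F r - df r) _ _ ab.
- move=> r; rewrite in_itv /= => /andP[ar _].
  by apply: is_deriveB; apply: is_derive_radial => //; exact: le_lt_trans ar.
- move=> r; apply: cvgB; first exact: continuous_radial.
  apply: continuous_subspaceT => s.
  by apply: differentiable_continuous; apply/derivable1_diffP; case: (fdf s).
by rewrite in_itv /= => rab E; exists r.
Qed.

Lemma radial_bregman_ge0 a b : 0 <= a -> 0 <= b ->
  0 <= Phi b - Phi a - F a * (b - a).
Proof.
move=> a_ge0 b_ge0.
have dl r : is_derive r 1 (fun s : R => F a * s) (F a).
  by apply: is_derive_eq; rewrite /GRing.scale /= mulr1.
case: (lerP a b) => [ab|/ltW ba].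
  have [r /andP[ar rb] E] := radial_mvt a_ge0 ab dl.
  have : 0 <= (F r - F a) * (b - a) by rewrite mulr_ge0 ?subr_ge0 // le_reg_slope.
  lra.
have [r /andP[br ra] E] := radial_mvt b_ge0 ba dl.
have : 0 <= (F a - F r) * (a - b).
  by rewrite mulr_ge0 ?subr_ge0 // le_reg_slope // (le_trans b_ge0).
lra.
Qed.

(** Strong convexity between [a] and [b]: the curvature bound [1 / ((r + alpha) * eta r)] decreases
    in [r], so its value at the larger radius serves for the whole segment. *)
Lemma radial_bregman_ge a b : 0 <= a -> 0 <= b ->
  (b - a) ^+ 2 / (2 * ((Num.max a b + alpha) * eta (Num.max a b))) <=
    Phi b - Phi a - F a * (b - a).
Proof.
move=> a_ge0 b_ge0; set M := Num.max a b.
have [->|ab_neq] := eqVneq a b; first by rewrite !subrr expr0n mul0r mulr0 subr0.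
have M_gt0 : 0 < M.
  rewrite lt_max !lt_neqAle a_ge0 b_ge0 !andbT -negb_and; apply: contra ab_neq.
  by move=> /andP[/eqP <- /eqP <-].
have q_gt0 : 0 < (M + alpha) * eta M.
  by rewrite mulr_gt0 ?rate_gt0 // shift_gt0 // ltW.
rewrite invfM [2^-1 * _]mulrC mulrA; set p := (_ * eta M)^-1.
have dq r : is_derive r 1 (fun s : R => F a * s + (s - a) ^+ 2 * p / 2)
    (F a + (r - a) * p).
  by apply: is_derive_eq; rewrite /GRing.scale /= !mulr1 subr0; field.
case: (lerP a b) => [ab|/ltW ba].
  have [r /andP[ar rb] E] := radial_mvt a_ge0 ab dq.
  suff : 0 <= (F r - F a - (r - a) * p) * (b - a) by lra.
  rewrite mulr_ge0 ?subr_ge0 //.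
  apply: le_trans (reg_slopeB_ge _ _ _ a_ge0 ar) => //.
  move: ar; rewrite le_eqVlt => /predU1P[->|ar]; first by rewrite subrr !mul0r.
  have r_gt0 : 0 < r by exact: le_lt_trans ar.
  rewrite ler_pM2l ?subr_gt0 // lef_pV2 ?posrE //; last first.
    by rewrite mulr_gt0 ?rate_gt0 // shift_gt0 // ltW.
  have -> : M = b by apply/max_idPr.
  by rewrite ler_pM ?rate_ge0 ?lerD2r ?le_rate // ltW // shift_gt0 // ltW.
have [r /andP[br ra] E] := radial_mvt b_ge0 ba dq.
suff : 0 <= (F a - F r - (a - r) * p) * (a - b) by lra.
rewrite mulr_ge0 ?subr_ge0 // /p /M (max_idPl ba).
by apply: reg_slopeB_ge => //; exact: le_trans br.
Qed.

(* [rho], [z] stand for the distance and the tangential defect of two points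
   with radii [a], [b] = [a +- m]; either the radial part of the linear term
   dominates, or the radii are so close that a square can be completed. *)
Lemma tangential_split c a m rho z y :
  0 <= c -> 0 <= a -> 0 <= m -> 0 <= rho -> 0 <= z -> 0 < y \/ a = 0 /\ y = 0 ->
  rho ^+ 2 = m ^+ 2 + 2 * a * z ->
  c * rho - y * z <= c * m \/
  [/\ 0 < a, 0 < y, y * m <= c * a & y * (c * rho - y * z) <= c ^+ 2 * a].
Proof.
move=> c_ge0 a_ge0 m_ge0 rho_ge0 z_ge0 ya rhoE.
have [a0|a_neq0] := eqVneq a 0.
  left; have : rho ^+ 2 = m ^+ 2 by rewrite rhoE a0; ring.
  move=> /eqP; rewrite eqrXn2 // => /eqP ->.
  by rewrite gerBl mulr_ge0 //; case: ya => [/ltW|[_ ->]].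
have a_gt0 : 0 < a by rewrite lt_neqAle eq_sym a_neq0.
have y_gt0 : 0 < y by case: ya => // -[a0]; rewrite a0 eqxx in a_neq0.
have a2 : 0 < 2 * a by rewrite mulr_gt0.
have m_rho : m <= rho.
  rewrite -(@ler_pXn2r _ 2) ?nnegrE // rhoE lerDl.
  by rewrite !mulr_ge0.
case: (lerP (c * a) (y * m)) => [le_ym|/ltW lt_ym]; [left|right; split => //].
- rewrite -subr_ge0 -(pmulr_rge0 _ a2).
  (* The factor [2 * a] lets [rhoE] eliminate [z]. The second factor is nonnegative because
     [c * a <= y * m <= y * rho]. *)
  have -> : 2 * a * (c * m - (c * rho - y * z)) =
      (rho - m) * (y * (rho + m) - 2 * (c * a)).
    have -> : (rho - m) * (y * (rho + m) - 2 * (c * a)) =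
      y * (rho ^+ 2 - m ^+ 2) - 2 * (c * a) * (rho - m) by ring.
    by rewrite rhoE; ring.
  rewrite mulr_ge0 ?subr_ge0 //.
  have := ler_wpM2l (ltW y_gt0) m_rho; lra.
- rewrite -subr_ge0 -(pmulr_rge0 _ a2).
  (* Completes the square in [rho]. *)
  have -> : 2 * a * (c ^+ 2 * a - y * (c * rho - y * z)) =
      (c * a - y * rho) ^+ 2 + ((c * a) ^+ 2 - (y * m) ^+ 2).
    have -> : (c * a - y * rho) ^+ 2 = (c * a) ^+ 2 - 2 * (c * a * y * rho)
      + y ^+ 2 * rho ^+ 2 by ring.
    by rewrite rhoE; ring.
  rewrite addr_ge0 ?sqr_ge0 // subr_ge0 ler_pXn2r // nnegrE mulr_ge0 //.
  exact: ltW.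
Qed.

(** The purpose of the cap on the step size: hint errors are at most [2 * G]. *)
Lemma mul_rate_le c r : 0 <= c <= 2 * G -> c * eta r <= 1.
Proof.
move=> /andP[c_ge0 cG]; have G2 : 0 < 2 * G by rewrite mulr_gt0.
apply: (@le_trans _ _ (2 * G * (2 * G)^-1)); last by rewrite divff ?gt_eqF.
by apply: ler_pM; rewrite ?rate_ge0 ?rate_le.
Qed.

(* Beyond the radius [3 * b + 2 * alpha] the Bregman divergence alone dominates. *)
Lemma radial_stability c k a b :
  0 <= c <= 2 * G -> 3 <= k -> 0 <= a -> 0 <= b ->
  c * `|b - a| - k * (Phi b - Phi a - F a * (b - a)) <=
    c ^+ 2 * ((b + alpha) * eta (3 * b + 2 * alpha)) / 2.
Proof.
move=> cG k_ge3 a_ge0 b_ge0; have /andP[c_ge0 _] := cG.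
have al_gt0 := alpha_gt0.
have D_ge0 := radial_bregman_ge0 a_ge0 b_ge0.
have := radial_bregman_ge a_ge0 b_ge0.
set D := _ - F a * _ in D_ge0 *; set M := Num.max a b; set N := _ + 2 * alpha.
have kD : 3 * D <= k * D by rewrite ler_wpM2r.
rewrite -[(b - a) ^+ 2]real_normK ?num_real //.
set m := `|b - a| => DM.
have m_ge0 : 0 <= m := normr_ge0 _.
have N_gt0 : 0 < N by rewrite /N; lra.
have RN : 0 <= (b + alpha) * eta N.
  by rewrite mulr_ge0 ?rate_ge0 // ltW // shift_gt0.
have c2_ge0 := sqr_ge0 c.
have [M0|M_neq0] := eqVneq M 0.
  have b0 : b = 0 by apply/le_anti; rewrite b_ge0 -M0 /M le_max lexx orbT.
  have a0 : a = 0 by apply/le_anti; rewrite a_ge0 -M0 /M le_max lexx.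
  have -> : m = 0 by rewrite /m a0 b0 subrr normr0.
  have := mulr_ge0 c2_ge0 RN; lra.
have M_gt0 : 0 < M by rewrite lt_neqAle eq_sym M_neq0 le_max a_ge0.
have Mal : 0 < M + alpha by lra.
set q := (M + alpha) * eta M in DM.
have q_gt0 : 0 < q by rewrite mulr_gt0 ?rate_gt0.
have cq : c * q <= M + alpha.
  by rewrite mulrCA ler_piMr ?(ltW Mal) // mul_rate_le.
case: (lerP M N) => [MN|NM].
  (* [M <= N] means [M + alpha <= 3 * (b + alpha)]. This [3] and the [6] from the square below
     produce the factor [1 / 2] of the claim. *)
  have qR : q <= 3 * ((b + alpha) * eta N).
    rewrite mulrA /q; apply: ler_pM; rewrite ?rate_ge0 ?(ltW Mal) //.
      by move: MN; rewrite /N; lra.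
    by apply: le_rate => //; exact: ltW.
  have H : 3 * (m ^+ 2 / (2 * q)) =
      c * m - c ^+ 2 * q / 6 + (c * q - 3 * m) ^+ 2 / (6 * q).
    by field; rewrite gt_eqF.
  have : 0 <= (c * q - 3 * m) ^+ 2 / (6 * q).
    by rewrite divr_ge0 ?sqr_ge0 // mulr_ge0 // ltW.
  have := ler_wpM2l c2_ge0 qR; lra.
have Ma : M = a.
  apply/max_idPl; rewrite leNgt; apply/negP => ab.
  by move: NM; rewrite /M (max_idPr (ltW ab)) /N; lra.
have mE : m = a - b.
  by rewrite /m distrC ger0_norm // subr_ge0; move: NM; rewrite Ma /N; lra.
(* The choice of [N] is the threshold for this inequality, which with [c * q <= M + alpha] lets the
   quadratic lower bound dominate [c * m]. *)
have H : 2 * (M + alpha) <= 3 * m by move: NM; rewrite mE Ma /N; lra.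
have : c * m <= 3 * (m ^+ 2 / (2 * q)).
  rewrite mulrA ler_pdivlMr; last by rewrite mulr_gt0.
  have -> : c * m * (2 * q) = m * (2 * (c * q)) by ring.
  have -> : 3 * m ^+ 2 = m * (3 * m) by ring.
  by rewrite ler_wpM2l //; lra.
have := mulr_ge0 c2_ge0 RN; lra.
Qed.

(** The first alternative of [tangential_split] reduces to [radial_stability]. In the second, the
    linear and tangential terms cost at most [c ^+ 2 * q / 3], and the radii are close enough to
    compare [q] with its analogue at [b]. *)
Lemma stability c k a b rho z :
  0 <= c <= 2 * G -> 3 <= k -> 0 <= a -> 0 <= b -> 0 <= rho -> 0 <= z ->
  rho ^+ 2 = (b - a) ^+ 2 + 2 * a * z ->
  c * rho - k * F a * z - k * (Phi b - Phi a - F a * (b - a)) <=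
    c ^+ 2 * ((b + alpha) * eta (3 * b + 2 * alpha)) / 2.
Proof.
move=> cG k_ge3 a_ge0 b_ge0 rho_ge0 z_ge0 rhoE; have /andP[c_ge0 _] := cG.
have al_gt0 := alpha_gt0.
have k_gt0 : 0 < k by lra.
have y0 : 0 < k * F a \/ a = 0 /\ k * F a = 0.
  move: a_ge0; rewrite le_eqVlt => /predU1P[<-|a_gt0].
    by right; rewrite reg_slope0 // mulr0.
  by left; rewrite mulr_gt0 // reg_slope_gt0.
move: rhoE; rewrite -[(b - a) ^+ 2]real_normK ?num_real // => rhoE.
case: (tangential_split c_ge0 a_ge0 (normr_ge0 (b - a)) rho_ge0 z_ge0 y0 rhoE).
  by have := radial_stability cG k_ge3 a_ge0 b_ge0; lra.
case; set m := `|b - a|; set N := 3 * b + _ => a_gt0 y_gt0 ym yE.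
have kD : 0 <= k * (Phi b - Phi a - F a * (b - a)).
  by apply: mulr_ge0; [exact: ltW|exact: radial_bregman_ge0].
set q := (a + alpha) * eta a.
have F_gt0 : 0 < F a by rewrite reg_slope_gt0.
have aq : a <= F a * q by apply: reg_slope_ge.
have q_ge0 : 0 <= q by rewrite mulr_ge0 ?rate_ge0 //; lra.
have cq : c * q <= a + alpha.
  by rewrite mulrCA ler_piMr ?mul_rate_le //; lra.
have c2_ge0 := sqr_ge0 c.
(* Combines [k * F a * m <= c * a] with [a <= F a * q] and cancels [F a]. Hence
   [a + alpha <= 3 / 2 * (b + alpha)]. *)
have m3 : 3 * m <= a + alpha.
  apply: le_trans cq; rewrite -(ler_pM2l F_gt0).
  have := ler_wpM2l c_ge0 aq.
  have : 3 * (F a * m) <= k * (F a * m).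
    by rewrite ler_wpM2r // mulr_ge0 ?normr_ge0 // ltW.
  by lra.
have ab : a - b <= m by rewrite /m distrC ler_norm.
have qN : q <= 3 / 2 * ((b + alpha) * eta N).
  rewrite mulrA; apply: ler_pM; rewrite ?rate_ge0 //; [lra|lra|].
  by apply: le_rate => //; rewrite /N; lra.
have : c * rho - k * F a * z <= c ^+ 2 * q / 3.
  rewrite -(ler_pM2l y_gt0); apply: le_trans yE _.
  have := ler_wpM2l c2_ge0 aq.
  have : 3 * (F a * (c ^+ 2 * q)) <= k * (F a * (c ^+ 2 * q)).
    by rewrite ler_wpM2r // mulr_ge0 ?(ltW F_gt0) // mulr_ge0.
  lra.
have := ler_wpM2l c2_ge0 qN; lra.
Qed.

End RadialBounds.

(** * Growth of the profile between consecutive rounds *)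

Section Growth.
Context (R : realType) (G V V' alpha alpha' : R).
Hypotheses (G_gt0 : 0 < G) (V_gt0 : 0 < V) (alpha'_gt0 : 0 < alpha').
Hypotheses (VV' : V <= V') (alpha'_le : alpha' <= alpha).
Local Notation eta' := (rate G V' alpha).
Implicit Types b c k r : R.

Let alpha_gt0 : 0 < alpha. Proof. exact: lt_le_trans alpha'_le. Qed.
Let V'_gt0 : 0 < V'. Proof. exact: lt_le_trans VV'. Qed.

(** The parameters change one at a time: for [V], the old objective is tested with the step size
    optimal for [V']; lowering [alpha] only increases the logarithm. *)
Lemma reg_slope_gap r : 0 < r ->
  reg_slope G V alpha r + eta' r * (V' - V) <= reg_slope G V' alpha' r.
Proof.
move=> r_gt0; have r_ge0 := ltW r_gt0.
apply: (@le_trans _ _ (reg_slope G V' alpha r)).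
  rewrite (reg_slopeE G_gt0 V'_gt0 alpha_gt0) //.
  have : reg_slope G V alpha r <= log_radius alpha r / eta' r + eta' r * V.
    by apply: reg_slope_le; rewrite // rate_le rate_gt0.
  lra.
rewrite (reg_slopeE G_gt0 V'_gt0 alpha'_gt0) //.
have e'_gt0 : 0 < rate G V' alpha' r by rewrite rate_gt0.
apply: (@le_trans _ _
  (log_radius alpha r / rate G V' alpha' r + rate G V' alpha' r * V')).
  by apply: reg_slope_le; rewrite // rate_le rate_gt0.
rewrite lerD2r ler_pM2r ?invr_gt0 // ler_ln ?posrE ?ltr_wpDl ?divr_ge0 //; last 2 first.
- exact: ltW.
- exact: ltW.
by rewrite lerD2r ler_wpM2l // lef_pV2.
Qed.

(** The slope gap is collected over the outer half [[b / 2, b]], where the step size is at least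
    [eta' (b / 2)]; the inner half contributes a nonnegative amount. *)
Lemma radial_gap b : 0 <= b ->
  radial G V alpha b + b / 2 * (eta' (b / 2) * (V' - V)) <= radial G V' alpha' b.
Proof.
move=> b_ge0.
have mvt p q : 0 <= p -> p < q -> exists2 r, p < r &
   (radial G V' alpha' q - radial G V alpha q)
     - (radial G V' alpha' p - radial G V alpha p) =
   (reg_slope G V' alpha' r - reg_slope G V alpha r) * (q - p).
  move=> p_ge0 pq.
  have [||r] := @MVT R (fun r => radial G V' alpha' r - radial G V alpha r)
    (fun r => reg_slope G V' alpha' r - reg_slope G V alpha r) _ _ pq.
  - move=> r; rewrite in_itv /= => /andP[pr _].
    by apply: is_deriveB; apply: is_derive_radial => //; exact: le_lt_trans pr.
  - by move=> r; apply: cvgB; exact: continuous_radial.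
  by rewrite in_itv /= => /andP[pr _] E; exists r.
move: b_ge0; rewrite le_eqVlt => /predU1P[<-|b_gt0].
  by rewrite !radial0 mul0r mul0r addr0.
have b2_gt0 : 0 < b / 2 by lra.
have b2b : b / 2 < b by lra.
have [r r_gt E] := mvt _ _ (ltW b2_gt0) b2b.
have [s s_gt0 E'] := mvt _ _ (lexx 0) b2_gt0.
have r_gt0 := lt_trans b2_gt0 r_gt.
move: E'; rewrite !radial0 !subr0 => E'.
have : 0 <= (reg_slope G V' alpha' s - reg_slope G V alpha s) * (b / 2).
  rewrite mulr_ge0 ?(ltW b2_gt0) // subr_ge0.
  apply: le_trans (reg_slope_gap s_gt0).
  by rewrite lerDl mulr_ge0 ?rate_ge0 // subr_ge0.
have : eta' (b / 2) * (V' - V) * (b / 2) <=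
    (reg_slope G V' alpha' r - reg_slope G V alpha r) * (b - b / 2).
  have -> : b - b / 2 = b / 2 by lra.
  rewrite ler_pM2r // lerBrDl; apply: le_trans (reg_slope_gap r_gt0).
  by rewrite lerD2l ler_wpM2r ?subr_ge0 // le_rate // ltW.
lra.
Qed.

Lemma log_radius_triple_le4 b : 0 <= b -> b <= 3 * alpha ->
  log_radius alpha (3 * b + 2 * alpha) <= 4.
Proof.
move=> b_ge0 ba; rewrite /log_radius.
have -> : (3 * b + 2 * alpha) / alpha + 1 = 3 * (b / alpha + 1).
  by field; rewrite gt_eqF.
have ba0 : 0 <= b / alpha by rewrite divr_ge0 // ltW.
have ba3 : b / alpha <= 3 by rewrite ler_pdivrMr.
apply: (@le_trans _ _ (ln (3 * 4))); first by rewrite ler_ln ?posrE; lra.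
(* With [ln (1 + t) <= t] this gives [2 + 1 + 1 = 4]. *)
have -> : (3 * 4 : R) = (1 + 2) * (1 + 1) * (1 + 1) by ring.
have [p2 p3] : (0 : R) < 1 + 1 /\ (0 : R) < 1 + 2 by split; lra.
rewrite !lnM ?posrE ?mulr_gt0 //.
have := @le_ln1Dx R 2; have := @le_ln1Dx R 1; lra.
Qed.

Lemma log_radius_triple_le b : 3 * alpha <= b ->
  log_radius alpha (3 * b + 2 * alpha) <= 3 * log_radius alpha (b / 2).
Proof.
move=> ba; rewrite /log_radius.
have -> : (3 * b + 2 * alpha) / alpha + 1 = 3 * (b / alpha + 1).
  by field; rewrite gt_eqF.
have -> : b / 2 / alpha = b / alpha / 2 by field; rewrite gt_eqF.
have : 3 <= b / alpha by rewrite ler_pdivlMr.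
set u := b / alpha => u3.
rewrite [leRHS]mulr_natl -lnXn; last by lra.
rewrite ler_ln ?posrE ?exprn_gt0; try lra.
(* Division by [u - 3], so that the sign is visible for [u >= 3]. *)
have -> : (u / 2 + 1) ^+ 3 = 3 * (u + 1) +
  ((u - 3) * (u ^+ 2 / 8 + 9 / 8 * u + 15 / 8) + 29 / 8) by field.
rewrite lerDl addr_ge0 // mulr_ge0 //; first lra.
by have := sqr_ge0 u; lra.
Qed.

(** For [b <= 3 * alpha] the left side is within the leftover term, since the step size is at most
    [2 / Num.sqrt V]. For larger [b] tripling the radius at most doubles the step size relative to
    [eta' (b / 2)], so three times the growth suffices. *)
Lemma stability_le_growth b c : 0 <= b -> V' = V + c ^+ 2 -> 4 * c ^+ 2 <= V ->
  c ^+ 2 * ((b + alpha) * rate G V alpha (3 * b + 2 * alpha)) / 2 <=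
  3 * (b / 2 * (eta' (b / 2) * (V' - V))) + 4 * c ^+ 2 * alpha / Num.sqrt V.
Proof.
move=> b_ge0 V'E cV; have al_gt0 := alpha_gt0.
have -> : V' - V = c ^+ 2 by rewrite V'E addrC addKr.
have c2_ge0 := sqr_ge0 c.
have s_gt0 : 0 < Num.sqrt V by rewrite sqrtr_gt0.
have e'_ge0 := rate_ge0 V' alpha G_gt0 (b / 2).
have two : Num.sqrt (2 ^+ 2) = 2 :> R by rewrite sqrtr_sqr ger0_norm.
case: (lerP b (3 * alpha)) => [b_le|/ltW b_ge].
  have H1 : rate G V alpha (3 * b + 2 * alpha) <= 2 / Num.sqrt V.
    rewrite ge_min; apply/orP; left.
    rewrite sqrtrM; last by apply: log_radius_ge0 => //; lra.
    rewrite sqrtrV ?(ltW V_gt0) // ler_pM2r ?invr_gt0 //.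
    rewrite -[leRHS]two.
    rewrite ler_wsqrtr //; apply: le_trans (log_radius_triple_le4 b_ge0 b_le) _.
    by lra.
  have : (b + alpha) * rate G V alpha (3 * b + 2 * alpha) <=
      4 * alpha * (2 / Num.sqrt V).
    by apply: ler_pM; rewrite ?rate_ge0 //; lra.
  move=> /(ler_wpM2l c2_ge0) H2.
  have : 0 <= b / 2 * (eta' (b / 2) * c ^+ 2).
    by rewrite mulr_ge0 ?divr_ge0 // mulr_ge0.
  lra.
have b_gt0 : 0 < b by lra.
have H1 : rate G V alpha (3 * b + 2 * alpha) <= 2 * eta' (b / 2).
  rewrite {2}/rate minr_pMr // le_min; apply/andP; split; last first.
    apply: le_trans (rate_le _ _ _ _) _.
    by rewrite ler_peMl ?invr_ge0 ?mulr_ge0 ?(ltW G_gt0) //; lra.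
  rewrite ge_min; apply/orP; left.
  rewrite -[X in X * Num.sqrt _]two -sqrtrM ?sqr_ge0 // ler_wsqrtr // ler_pdivrMr //.
  have l_ge0 : 0 <= log_radius alpha (b / 2) by apply: log_radius_ge0 => //; lra.
  apply: le_trans (log_radius_triple_le b_ge) _.
  have -> : 2 ^+ 2 * (log_radius alpha (b / 2) / V') * V =
    log_radius alpha (b / 2) * (4 * V / V') by ring.
  rewrite [leLHS]mulrC ler_wpM2l // ler_pdivlMr //.
  by rewrite V'E; lra.
have : (b + alpha) * rate G V alpha (3 * b + 2 * alpha) <=
    (3 / 2 * b) * (2 * eta' (b / 2)).
  by apply: ler_pM; rewrite ?rate_ge0 //; lra.
move=> /(ler_wpM2l c2_ge0) H2.
have : 0 <= 4 * c ^+ 2 * alpha / Num.sqrt V.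
  by rewrite divr_ge0 ?(ltW s_gt0) // mulr_ge0 ?(ltW al_gt0) // mulr_ge0.
lra.
Qed.

(** Splitting the new profile at [b] into the old one plus its growth leaves the expression of
    [stability] minus [k] times the growth, and [3 <= k] covers the three copies required. *)
Lemma round_bound c k a b rho z :
  0 <= c <= 2 * G -> 3 <= k -> V' = V + c ^+ 2 -> 16 * G ^+ 2 <= V ->
  0 <= a -> 0 <= b -> 0 <= rho -> 0 <= z ->
  rho ^+ 2 = (b - a) ^+ 2 + 2 * a * z ->
  c * rho - k * reg_slope G V alpha a * (a - b + z)
    + k * radial G V alpha a - k * radial G V' alpha' b <=
  4 * c ^+ 2 * alpha / Num.sqrt V.
Proof.
move=> cG k_ge3 V'E VG a_ge0 b_ge0 rho_ge0 z_ge0 rhoE.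
(* The initial value [16 * G ^+ 2] is four times the largest possible [c ^+ 2]. *)
have cV : 4 * c ^+ 2 <= V.
  apply: le_trans VG; have /andP[c_ge0 cG'] := cG.
  by have := ler_pM c_ge0 c_ge0 cG' cG'; rewrite -!expr2; lra.
have := stability G_gt0 V_gt0 alpha_gt0 cG k_ge3 a_ge0 b_ge0 rho_ge0 z_ge0 rhoE.
have := stability_le_growth b_ge0 V'E cV.
have := radial_gap b_ge0; set gap := b / 2 * _ => gapP.
have gap_ge0 : 0 <= gap.
  by rewrite mulr_ge0 ?divr_ge0 // mulr_ge0 ?rate_ge0 ?subr_ge0.
have : k * (radial G V alpha b + gap) <= k * radial G V' alpha' b.
  by rewrite ler_wpM2l //; lra.
have : 3 * gap <= k * gap by rewrite ler_wpM2r.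
lra.
Qed.

End Growth.

(** * Euclidean inner product, subgradients and derivatives along lines *)

Section Euclidean.
Context (R : realType) (d : nat).
Implicit Types (x y v : 'rV[R]_d) (a : R).

Lemma dotpC x y : dotp x y = dotp y x.
Proof. by apply: eq_bigr => i _; rewrite mulrC. Qed.

Lemma dotpDl x y v : dotp (x + y) v = dotp x v + dotp y v.
Proof. by rewrite -big_split; apply: eq_bigr => i _; rewrite mxE mulrDl. Qed.

Lemma dotpZl a x y : dotp (a *: x) y = a * dotp x y.
Proof. by rewrite mulr_sumr; apply: eq_bigr => i _; rewrite mxE mulrA. Qed.

Lemma dotpDr x y v : dotp v (x + y) = dotp v x + dotp v y.
Proof. by rewrite dotpC dotpDl !(dotpC v). Qed.

Lemma dotpZr a x y : dotp x (a *: y) = a * dotp x y.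
Proof. by rewrite dotpC dotpZl dotpC. Qed.

Lemma dotpNl x y : dotp (- x) y = - dotp x y.
Proof. by rewrite -scaleN1r dotpZl mulN1r. Qed.

Lemma dotpNr x y : dotp x (- y) = - dotp x y.
Proof. by rewrite dotpC dotpNl dotpC. Qed.

Lemma dotp0l x : dotp 0 x = 0.
Proof. by rewrite -(scale0r x) dotpZl mul0r. Qed.

Lemma dotp_delta x i : dotp x (delta_mx 0 i) = x 0 i.
Proof.
rewrite /dotp (bigD1 i) //= mxE !eqxx mulr1 big1 ?addr0 // => j ji.
by rewrite mxE (negPf ji) andbF mulr0.
Qed.

Lemma dotp_ge0 x : 0 <= dotp x x.
Proof. by apply: sumr_ge0 => i _; rewrite -expr2 sqr_ge0. Qed.

Lemma enorm_ge0 x : 0 <= enorm x.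
Proof. exact: sqrtr_ge0. Qed.

Lemma sqr_enorm x : enorm x ^+ 2 = dotp x x.
Proof. by rewrite sqr_sqrtr // dotp_ge0. Qed.

Lemma enorm_eq0 x : (enorm x == 0) = (x == 0).
Proof.
apply/idP/eqP => [|->]; last by rewrite /enorm dotp0l sqrtr0.
rewrite -sqrf_eq0 sqr_enorm psumr_eq0; last by move=> i _; rewrite -expr2 sqr_ge0.
move=> /allP x0; apply/rowP => i; rewrite mxE; apply/eqP.
by have := x0 i (mem_index_enum i); rewrite mulf_eq0 orbb.
Qed.

Lemma cauchy_schwarz x y : dotp x y <= enorm x * enorm y.
Proof.
have [->|x_neq0] := eqVneq x 0; first by rewrite dotp0l mulr_ge0 // enorm_ge0.
have [->|y_neq0] := eqVneq y 0; first by rewrite dotpC dotp0l mulr_ge0 // enorm_ge0.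
have nx : 0 < enorm x by rewrite lt_neqAle eq_sym enorm_eq0 x_neq0 enorm_ge0.
have ny : 0 < enorm y by rewrite lt_neqAle eq_sym enorm_eq0 y_neq0 enorm_ge0.
(* Expanding this square gives the inequality multiplied by [2 * enorm x * enorm y]. *)
have := dotp_ge0 (enorm y *: x - enorm x *: y).
rewrite dotpDl !dotpDr !(dotpNl, dotpNr, dotpZl, dotpZr) -!sqr_enorm (dotpC y x).
rewrite -[in X in _ -> X]subr_ge0.
rewrite -(pmulr_rge0 (enorm x * enorm y - dotp x y) (mulr_gt0 nx ny)).
by set p := enorm x; set q := enorm y; lra.
Qed.

(** Testing the subgradient inequality at [g + x] gives [enorm g ^+ 2 <= G * enorm g]. *)
Lemma subgradient_enorm_le (G : R) (f : 'rV[R]_d -> R) x g : 0 <= G ->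
  elipschitz G f -> subdifferential f x g -> enorm g <= G.
Proof.
move=> G_ge0 lip sub.
have [->//|g_neq0] := eqVneq (enorm g) 0.
have g_gt0 : 0 < enorm g by rewrite lt_neqAle eq_sym g_neq0 enorm_ge0.
have := sub (g + x); have := le_trans (ler_norm _) (lip (g + x) x).
rewrite addrK -sqr_enorm => H1 H2.
by rewrite -(ler_pM2r g_gt0) -expr2; lra.
Qed.

(** The two difference quotients coincide; this opens directional derivatives to one-variable
    calculus. *)
Lemma is_derive_line (f : 'rV[R]_d -> R) x v (t l : R) :
  is_derive (t *: v + x) v f l <-> is_derive t 1 (fun s : R => f (s *: v + x)) l.
Proof.
have E : (fun h : R => h^-1 *: (f (h *: v + (t *: v + x)) - f (t *: v + x))) =
  (fun h : R => h^-1 *: (f ((h *: 1 + t) *: v + x) - f (t *: v + x))).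
  by apply/funext => h; rewrite [h *: 1 in RHS]mulr1 [(h + t) *: v]scalerDl addrA.
split=> -[df Df]; split.
- by move: df; rewrite /derivable E.
- by move: Df; rewrite /derive E.
- by rewrite /derivable E.
- by rewrite /derive E.
Qed.

End Euclidean.

(** * Gradient of a radial regularizer and stationarity of minimizers *)

Section RadialGradient.
Context (R : realType) (d : nat) (G V alpha k : R).
Hypotheses (G_gt0 : 0 < G) (V_gt0 : 0 < V) (alpha_gt0 : 0 < alpha).
Local Notation F := (reg_slope G V alpha).
Local Notation Phi := (radial G V alpha).
Local Notation psi := (fun w : 'rV[R]_d => k * Phi (enorm w)).
Implicit Types (x y v w q : 'rV[R]_d).

(** At the origin the factor [y] gives the zero vector, the correct gradient because the slope tends
    to [0] there. *)
Definition radial_gradient y : 'rV[R]_d := (k * F (enorm y) / enorm y) *: y.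

Lemma radial_gradient0 : radial_gradient 0 = 0.
Proof. exact: scaler0. Qed.

Lemma enorm_line y v (s : R) :
  enorm (s *: v + y) = Num.sqrt (dotp v v * s ^+ 2 + 2 * dotp y v * s + dotp y y).
Proof.
congr Num.sqrt; rewrite dotpDl !dotpDr !(dotpZl, dotpZr) (dotpC v y); ring.
Qed.

Lemma reg_slope_cvg0 (c : R) : 0 <= c ->
  F (c * `|s|) @[s --> (0 : R)] --> (0 : R).
Proof.
move=> c_ge0.
have -> : (fun s : R => F (c * `|s|)) =
    (fun s => slope_closed_form G V alpha (c * `|s|)).
  by apply/funext => s; rewrite reg_slope_closed_form // mulr_ge0.
have E : slope_closed_form G V alpha 0 = 0.
  by rewrite -reg_slope_closed_form // reg_slope0.
have cc : {for (0 : R), continuous (fun s : R => c * `|s|)}.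
  by apply: cvgMr; apply: norm_continuous.
have cS : {for c * `|0 : R|, continuous (slope_closed_form G V alpha)}.
  by rewrite normr0 mulr0; exact: continuous_slope_closed_form.
have := continuous_comp cc cS.
by rewrite /prop_for /continuous_at /= normr0 mulr0 E.
Qed.

(** Away from the origin this is the chain rule through the square root of a quadratic polynomial.
    At the origin, convexity gives [Phi r <= F r * r], which squeezes the difference quotient to
    [0]. *)
Lemma is_derive_radial_comp y v :
  is_derive y v psi (dotp (radial_gradient y) v).
Proof.
suff : is_derive (0 *: v + y) v psi (dotp (radial_gradient y) v).
  by rewrite scale0r add0r.
apply/is_derive_line; rewrite dotpZl.
have [->|y_neq0] := eqVneq y 0.
  rewrite dotp0l mulr0.
  have E (s : R) : enorm (s *: v + 0) = enorm v * `|s|.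
    rewrite addr0 /enorm dotpZl dotpZr mulrA -expr2 sqrtrM ?sqr_ge0 //.
    by rewrite sqrtr_sqr mulrC.
  have C : (fun h : R => h^-1 *: (k * Phi (enorm ((h *: 1 + 0) *: v + 0)) -
      k * Phi (enorm (0 *: v + 0)))) @ 0^' --> (0 : R).
    have Q (h : R) : h != 0 -> `|h^-1 *: (k * Phi (enorm ((h *: 1 + 0) *: v + 0)) -
        k * Phi (enorm (0 *: v + 0)))| <= `|k| * enorm v * F (enorm v * `|h|).
      move=> h_neq0; rewrite !E normr0 mulr0 radial0 mulr0 subr0 addr0.
      have r_ge0 : 0 <= enorm v * `|h| by rewrite mulr_ge0 // enorm_ge0.
      rewrite normrM [h *: 1]mulr1 normrM normfV mulrCA -mulrA ler_wpM2l //.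
      rewrite ler_pdivrMl ?normr_gt0 //.
      have := radial_bregman_ge0 G_gt0 V_gt0 alpha_gt0 r_ge0 (lexx 0).
      have := radial_bregman_ge0 G_gt0 V_gt0 alpha_gt0 (lexx 0) r_ge0.
      by rewrite radial0 reg_slope0 // => H; rewrite ger0_norm; lra.
    have B : `|k| * enorm v * F (enorm v * `|h|) @[h --> (0 : R)^'] --> (0 : R).
      rewrite -[X in _ --> X](mulr0 (`|k| * enorm v)); apply: cvgMr.
      apply: cvg_trans (reg_slope_cvg0 (enorm_ge0 v)).
      by apply: cvg_app; exact: cvg_within.
    apply/norm_cvg0P; apply: (squeeze_cvgr _ (cvg_cst 0) B).
    near=> h; rewrite normr_ge0 /= Q //.
    near: h; exact: nbhs_dnbhs_neq.
  apply: DeriveDef; first by apply/cvg_ex; exists 0.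
  exact/cvg_lim.
have n_gt0 : 0 < enorm y by rewrite lt_neqAle eq_sym enorm_eq0 y_neq0 enorm_ge0.
pose P (s : R) := dotp v v * s ^+ 2 + 2 * dotp y v * s + dotp y y.
have -> : (fun s : R => k * Phi (enorm (s *: v + y))) =
    (fun s => k * (Phi \o (Num.sqrt \o P)) s).
  by apply/funext => s; rewrite enorm_line.
have dP : is_derive (0 : R) 1 P (2 * dotp y v).
  by apply: is_derive_eq; rewrite /GRing.scale /=; ring.
have P0 : P 0 = dotp y y by rewrite /P; ring.
have dS : is_derive (0 : R) 1 (Num.sqrt \o P) ((2 * enorm y)^-1 * (2 * dotp y v)).
  apply: is_derive1_comp; rewrite P0; apply: is_derive1_sqrt.
  by rewrite -sqr_enorm exprn_gt0.
have dF : is_derive (0 : R) 1 (Phi \o (Num.sqrt \o P))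
    (F (enorm y) * ((2 * enorm y)^-1 * (2 * dotp y v))).
  by apply: is_derive1_comp; rewrite /comp P0; exact: is_derive_radial.
apply: is_derive_eq; rewrite /GRing.scale /=; field.
by rewrite gt_eqF.
Unshelve. all: by end_near. Qed.

Lemma gradient_radial y : gradient psi y = radial_gradient y.
Proof.
apply/rowP => i; rewrite mxE.
by have [_ ->] := is_derive_radial_comp y (delta_mx 0 i); rewrite dotp_delta.
Qed.

(** Along the line through [x] with direction [p], the sum of the gradient and [q], the derivative
    at [x] is [dotp p p]; at a minimum it vanishes. *)
Lemma radial_stationary q x :
  argmin (fun v => dotp q v + psi v) x -> radial_gradient x = - q.
Proof.
move=> xmin; apply/eqP; rewrite -addr_eq0; apply/eqP.
set p := _ + q.
have dl (t : R) : is_derive t 1 (fun s : R => dotp q (s *: p + x) + psi (s *: p + x))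
   (dotp q p + dotp (radial_gradient (t *: p + x)) p).
  apply: is_deriveD; last first.
    by apply: (is_derive_line psi x p t _).1; exact: is_derive_radial_comp.
  have -> : (fun s : R => dotp q (s *: p + x)) = (fun s => dotp q p * s + dotp q x).
    by apply/funext => s; rewrite dotpDr dotpZr mulrC.
  by apply: is_derive_eq; rewrite /GRing.scale /=; ring.
have := @derive1_at_min R (fun s : R => dotp q (s *: p + x) + psi (s *: p + x)) (-1) 1 0.
case.
- by lra.
- by move=> t _; case: (dl t).
- by rewrite in_itv /= ltrN10 ltr01.
- by move=> t _; rewrite scale0r add0r; exact: xmin.
move=> _ D0; have [_] := dl 0; rewrite D0 scale0r add0r -dotpDl addrC -/p.
move=> /esym/eqP; rewrite -sqr_enorm sqrf_eq0 enorm_eq0 => /eqP //.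
Qed.

End RadialGradient.

(** * Telescoping bound for the logarithmic leftovers *)

(** The increment [l' - l] is comparable to [c / V], so the quotient is comparable to the decrease
    of [1 / l]; the constant [2] absorbs the losses from [c / V <= 1 / 4]. *)
Lemma ln_growth (R : realType) (G V c : R) : 0 < G -> 16 * G ^+ 2 <= V ->
  0 <= c <= 4 * G ^+ 2 ->
  let l := ln (V / G ^+ 2) in
  let l' := ln ((V + c) / G ^+ 2) in
  [/\ 2 <= l, l <= l' & c / (V * l ^+ 2) <= 2 / l - 2 / l'].
Proof.
move=> G_gt0 VG /andP[c_ge0 cG] l l'.
have G2_gt0 : 0 < G ^+ 2 by rewrite exprn_gt0.
have V_gt0 : 0 < V by apply: lt_le_trans VG; rewrite mulr_gt0.
have V'_gt0 : 0 < V + c by lra.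
have cV : 4 * c <= V by lra.
have l_ge2 : 2 <= l.
  (* [V / G ^+ 2] is at least [16 = 2 ^+ 4], and [ln 2 >= 1 / 2]. *)
  apply: (@le_trans _ _ (ln (2 ^+ 4))); last first.
    rewrite /l ler_ln ?posrE ?exprn_gt0 ?divr_gt0 // ler_pdivlMr //; lra.
  rewrite lnXn // -[leRHS]mulr_natl.
  have := @le_ln1Dx R (2^-1 - 1); rewrite [1 + _]addrC subrK lnV ?posrE //.
  by lra.
have ll' : l' - l = ln ((V + c) / V).
  rewrite /l /l' -ln_div ?posrE ?divr_gt0 //; congr ln.
  by field; rewrite !gt_eqF.
pose r := c / V.
have r_ge0 : 0 <= r by rewrite divr_ge0 // ltW.
have r_le : 4 * r <= 1 by rewrite mulrA ler_pdivrMr // mul1r.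
have up : l' - l <= r.
  rewrite ll'; have -> : (V + c) / V = 1 + r by rewrite /r; field; rewrite gt_eqF.
  by apply: le_ln1Dx; lra.
have low : 4 / 5 * r <= l' - l.
  (* Passing to the inverse turns the upper bound [ln (1 + t) <= t] into a lower bound. *)
  rewrite ll' -[(V + c) / V]invrK lnV ?posrE ?invr_gt0 ?divr_gt0 //.
  have -> : ((V + c) / V)^-1 = 1 - c / (V + c) by field; rewrite !gt_eqF.
  have s_ge : 4 / 5 * r <= c / (V + c).
    have rV : r * V = c by rewrite divfK ?gt_eqF.
    rewrite ler_pdivlMr //; have := ler_wpM2l c_ge0 r_le; lra.
  have s_lt : c / (V + c) < 1 by rewrite ltr_pdivrMr //; lra.
  by have := @le_ln1Dx R (- (c / (V + c))); lra.
have l_gt0 : 0 < l by lra.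
have l'_gt0 : 0 < l' by lra.
split=> //; first by lra.
have -> : 2 / l - 2 / l' = 2 * (l' - l) / (l * l') by field; rewrite !gt_eqF.
have -> : c / (V * l ^+ 2) = r / l ^+ 2 by rewrite /r invfM mulrA.
rewrite ler_pdivlMr ?mulr_gt0 // mulrAC ler_pdivrMr ?exprn_gt0 //.
have -> : r * (l * l') = l * (r * l') by ring.
have -> : 2 * (l' - l) * l ^+ 2 = l * (2 * (l' - l) * l) by ring.
rewrite ler_wpM2l ?(ltW l_gt0) //.
have := ler_wpM2r (ltW l_gt0) low.
have := ler_wpM2l r_ge0 up.
have := ler_wpM2r r_ge0 r_le.
have := ler_wpM2r r_ge0 l_ge2.
lra.
Qed.

(** * Regret along a run of the algorithm *)

Section Run.
Context (R : realType) (d T : nat) (G eps k : R).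
Context (ell ellhat : nat -> 'rV[R]_d -> R) (x w g h : nat -> 'rV[R]_d).
Hypotheses (G_gt0 : 0 < G) (eps_gt0 : 0 < eps) (k_ge3 : 3 <= k).
Hypothesis ell_lipschitz : forall t, (1 <= t <= T)%N -> elipschitz G (ell t).
Hypothesis ellhat_lipschitz :
  forall t, (1 <= t <= T)%N -> elipschitz G (ellhat t).
Hypothesis run : iocmd T ell ellhat (regularizer k eps G g h) x w g h.
Local Notation V := (Vhat G g h).
Local Notation alpha := (alphahat eps G g h).
Local Notation psi := (regularizer k eps G g h).
Local Notation c t := (enorm (g t - h t)).
Local Notation l t := (ln (V t / G ^+ 2)).
Implicit Type t n : nat.

Lemma Vhat_ge t : 16 * G ^+ 2 <= V t.
Proof. by rewrite lerDl sumr_ge0 // => s _; rewrite sqr_ge0. Qed.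

Lemma Vhat_gt0 t : 0 < V t.
Proof. by apply: lt_le_trans (Vhat_ge t); rewrite mulr_gt0 ?exprn_gt0. Qed.

Lemma VhatS t : (1 <= t)%N -> V t.+1 = V t + c t ^+ 2.
Proof. by move=> t1; rewrite /Vhat big_nat_recr //= addrA. Qed.

(** Both subgradients have norm at most [G]; the parallelogram identity bounds their difference. *)
Lemma hint_error_le t : (1 <= t <= T)%N -> 0 <= c t <= 2 * G.
Proof.
move=> tT; rewrite enorm_ge0 /=.
have gG := subgradient_enorm_le (ltW G_gt0) (ell_lipschitz tT) (iocmd_subgrad run tT).
have hG := subgradient_enorm_le (ltW G_gt0) (ellhat_lipschitz tT) (iocmd_hint run tT).
rewrite -(@ler_pXn2r _ 2) ?nnegrE ?enorm_ge0 ?mulr_ge0 ?(ltW G_gt0) //.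
have : enorm (g t + h t) ^+ 2 + c t ^+ 2 = 2 * enorm (g t) ^+ 2 + 2 * enorm (h t) ^+ 2.
  by rewrite !sqr_enorm !dotpDl !dotpDr !(dotpNl, dotpNr); ring.
have := sqr_ge0 (enorm (g t + h t)).
have sq z : 0 <= z -> z <= G -> z ^+ 2 <= G ^+ 2.
  by move=> z_ge0 zG; rewrite ler_pXn2r ?nnegrE // (le_trans z_ge0).
have := sq _ (enorm_ge0 _) gG; have := sq _ (enorm_ge0 _) hG; lra.
Qed.

Lemma ln_Vhat t : (1 <= t <= T)%N ->
  [/\ 2 <= l t, l t <= l t.+1 & c t ^+ 2 / (V t * l t ^+ 2) <= 2 / l t - 2 / l t.+1].
Proof.
move=> tT; have /andP[t1 _] := tT; rewrite VhatS //; apply: ln_growth => //.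
  exact: Vhat_ge.
rewrite sqr_ge0 /=; have /andP[c0 cG] := hint_error_le tT.
by have := ler_pM c0 c0 cG cG; rewrite -!expr2; lra.
Qed.

Lemma ln_Vhat_ge2 t : 2 <= l t.
Proof.
have G2_ge0 : (0 : R) <= 0 <= 4 * G ^+ 2 by rewrite lexx mulr_ge0 // sqr_ge0.
by have [] := ln_growth G_gt0 (Vhat_ge t) G2_ge0.
Qed.

Lemma alphahat_gt0 t : 0 < alpha t.
Proof.
have l_gt0 : 0 < l t by apply: lt_le_trans (ln_Vhat_ge2 t).
apply: divr_gt0; apply: mulr_gt0 => //; first by rewrite sqrtr_gt0 Vhat_gt0.
exact: exprn_gt0.
Qed.

Lemma alphahatS_le t : (1 <= t <= T)%N -> alpha t.+1 <= alpha t.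
Proof.
move=> tT; have [l2 ll' _] := ln_Vhat tT; have /andP[t1 _] := tT.
have l_gt0 : 0 < l t by exact: lt_le_trans l2.
have s_gt0 : 0 < Num.sqrt (V t) by rewrite sqrtr_gt0 Vhat_gt0.
have s'_gt0 : 0 < Num.sqrt (V t.+1) by rewrite sqrtr_gt0 Vhat_gt0.
have l'_gt0 : 0 < l t.+1 by exact: lt_le_trans ll'.
rewrite /alphahat ler_wpM2l ?mulr_ge0 ?(ltW eps_gt0) ?(ltW G_gt0) //.
rewrite lef_pV2 ?posrE ?mulr_gt0 ?exprn_gt0 //.
apply: ler_pM; rewrite ?exprn_ge0 ?sqrtr_ge0 ?(ltW l_gt0) //.
  by rewrite ler_wsqrtr // VhatS // lerDl sqr_ge0.
by rewrite ler_pXn2r ?nnegrE ?(ltW l_gt0) // (le_trans (ltW l_gt0)).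
Qed.

Local Notation grad t := (radial_gradient G (V t) (alpha t) k).

Lemma regularizerE t y : psi t y = k * radial G (V t) (alpha t) (enorm y).
Proof. by []. Qed.

Lemma gradient_regularizer t y : gradient (psi t) y = grad t y.
Proof.
by apply: gradient_radial; [exact: G_gt0|exact: Vhat_gt0|exact: alphahat_gt0].
Qed.

Lemma regularizer_stationary t q y :
  argmin (fun v => dotp q v + psi t v) y -> grad t y = - q.
Proof.
by apply: radial_stationary; [exact: G_gt0|exact: Vhat_gt0|exact: alphahat_gt0].
Qed.

Lemma regularizer0 t : psi t 0 = 0.
Proof.
have := radial0 G (V t) (alpha t); rewrite /radial /regularizer.
have -> : enorm (0 : 'rV[R]_d) = 0 by apply/eqP; rewrite enorm_eq0.
by move=> ->; rewrite mulr0.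
Qed.

Local Opaque regularizer.

(** The slope is positive at positive radii, so the gradient vanishes only at the origin. *)
Lemma iocmd_init0 : x 1%N = 0.
Proof.
have k_gt0 : 0 < k by apply: lt_le_trans k_ge3.
have : grad 1%N (x 1%N) = - 0.
  apply: regularizer_stationary => y; rewrite !dotp0l !add0r.
  exact: (iocmd_init run).
move=> /eqP; rewrite oppr0 scaler_eq0 => /orP[|/eqP //].
have [->//|x_neq0] := eqVneq (x 1%N) 0.
have n_gt0 : 0 < enorm (x 1%N) by rewrite lt_neqAle eq_sym enorm_eq0 x_neq0 enorm_ge0.
rewrite !mulf_eq0 invr_eq0 !gt_eqF //.
by apply: reg_slope_gt0 => //; [exact: Vhat_gt0|exact: alphahat_gt0].
Qed.

Definition grad_sum t : 'rV[R]_d := \sum_(1 <= s < t) g s.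

(** By induction the gradient of [psi t] at [x t] is [- grad_sum t], so the divergence in the update
    is [psi t v + dotp (grad_sum t) v] up to a constant. The centering term, based at [x 1 = 0],
    replaces [psi t] by [psi t.+1]. *)
Lemma iocmd_leader t : (1 <= t <= T.+1)%N ->
  argmin (fun v => dotp (grad_sum t) v + psi t v) (x t).
Proof.
case: t => // t; elim: t => [|t IH] tT.
  move=> y; rewrite /grad_sum big_geq // !dotp0l !add0r; exact: (iocmd_init run).
have tT' : (1 <= t.+1 <= T)%N by [].
have st := regularizer_stationary (IH (leqW tT')).
move=> y; have := iocmd_update run tT' y.
have -> : grad_sum t.+2 = grad_sum t.+1 + g t.+1 by rewrite /grad_sum big_nat_recr.
rewrite /bregman !gradient_regularizer st iocmd_init0 !radial_gradient0.
have := regularizer0 t.+2; have := regularizer0 t.+1.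
move: (psi t.+1) (psi t.+2) (grad_sum t.+1) => P Q S P0 Q0.
rewrite P0 Q0 !dotp0l !subr0 !dotpDl !dotpDr !(dotpNl, dotpNr); lra.
Qed.

Definition leader_value t : R := dotp (grad_sum t) (x t) + psi t (x t).

Lemma round_regret t : (1 <= t <= T)%N ->
  dotp (g t) (w t) + leader_value t - leader_value t.+1 <=
    4 * eps * G * (2 / l t - 2 / l t.+1).
Proof.
move=> tT; have /andP[t1 tT1] := tT.
have tT' : (1 <= t <= T.+1)%N by rewrite t1 leqW.
have [l2 ll' budget] := ln_Vhat tT.
have := iocmd_optimality run tT.
rewrite !gradient_regularizer (regularizer_stationary (iocmd_leader tT')) opprK.
move=> opt; have gw : grad t (w t) = - (grad_sum t + h t).
  by apply/eqP; rewrite -addr_eq0 [_ + h t]addrC addrA [_ + h t]addrC opt.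
have := iocmd_leader tT' (w t); rewrite /leader_value.
have -> : grad_sum t.+1 = grad_sum t + g t by rewrite /grad_sum big_nat_recr.
set y := x t.+1; set v := w t; set th := grad_sum t => leader.
set a := enorm v; set b := enorm y.
have sl_ge0 := reg_slope0 G_gt0 (Vhat_gt0 t) (alphahat_gt0 t).
(* The tangential defect: [b] minus the component of [y] along [v]. For [v = 0] division by zero
   gives [z = b], which is harmless since [a] and the slope at [a] vanish. *)
pose z := b - dotp v y / a.
have a_ge0 : 0 <= a := enorm_ge0 _.
have b_ge0 : 0 <= b := enorm_ge0 _.
have [z_ge0 az yz] : [/\ 0 <= z, a * z = a * b - dotp v y &
    dotp (grad t v) (v - y) = k * reg_slope G (V t) (alpha t) a * (a - b + z)].
  have [v0|v_neq0] := eqVneq v 0.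
    have a0 : a = 0 by apply/eqP; rewrite enorm_eq0 v0.
    rewrite /z /radial_gradient v0 scaler0 !dotp0l mul0r !subr0 a0 sl_ge0.
    by split=> //; rewrite ?mulr0 !mul0r.
  have a_gt0 : 0 < a by rewrite lt_neqAle eq_sym enorm_eq0 v_neq0.
  split.
  - by rewrite subr_ge0 ler_pdivrMr // mulrC cauchy_schwarz.
  - by rewrite /z; field; rewrite gt_eqF.
  - rewrite /radial_gradient dotpZl dotpDr dotpNr -sqr_enorm -/a /z.
    by field; rewrite gt_eqF.
(* The law of cosines. *)
have rhoE : enorm (v - y) ^+ 2 = (b - a) ^+ 2 + 2 * a * z.
  rewrite -mulrA az sqr_enorm dotpDl !dotpDr !(dotpNl, dotpNr) -!sqr_enorm (dotpC y v).
  by rewrite -/a -/b; ring.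
have cs := cauchy_schwarz (g t - h t) (v - y).
(* By [gw] the hint cancels on the right, leaving the linear parts of the two leader objectives and
   the gradient term. *)
have gtE : dotp (g t - h t) (v - y) =
    dotp (g t) v + dotp th v - dotp (th + g t) y + dotp (grad t v) (v - y).
  by rewrite gw !dotpDl !dotpDr !(dotpNl, dotpNr) !dotpDl; ring.
have := round_bound G_gt0 (Vhat_gt0 t) (alphahat_gt0 t.+1) _ (alphahatS_le tT)
  (hint_error_le tT) k_ge3 (VhatS t1) (Vhat_ge t) a_ge0 b_ge0 (enorm_ge0 (v - y))
  z_ge0 rhoE.
rewrite VhatS // lerDl sqr_ge0 => /(_ isT); rewrite -VhatS // => rb.
(* The square root and squared logarithm in [alphahat] turn the leftover into the telescoping
   quantity of [ln_growth]. *)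
have costE : 4 * c t ^+ 2 * alpha t / Num.sqrt (V t) =
    4 * eps * G * (c t ^+ 2 / (V t * l t ^+ 2)).
  have s_gt0 : 0 < Num.sqrt (V t) by rewrite sqrtr_gt0 Vhat_gt0.
  have l_gt0 : 0 < l t by exact: lt_le_trans l2.
  have VE : V t = Num.sqrt (V t) ^+ 2 by rewrite sqr_sqrtr // ltW // Vhat_gt0.
  rewrite /alphahat; move: s_gt0 l_gt0 VE.
  set s := Num.sqrt _; set l0 := ln _ => s_gt0 l_gt0 ->; field.
  by rewrite !gt_eqF.
have eG_ge0 : 0 <= 4 * eps * G by rewrite !mulr_ge0 // ltW.
have := ler_wpM2l eG_ge0 budget; rewrite -costE.
move: leader; rewrite (regularizerE t v) (regularizerE t.+1 y) -/a -/b.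
move: (psi t (x t)) => px; lra.
Qed.

Lemma leader_regret n : (n <= T)%N ->
  \sum_(1 <= t < n.+1) dotp (g t) (w t) - leader_value n.+1 <=
    4 * eps * G * (2 / l 1%N - 2 / l n.+1).
Proof.
elim: n => [|n IH] nT.
  rewrite big_geq // /leader_value /grad_sum big_geq // dotp0l iocmd_init0.
  by rewrite regularizer0 !subrr addr0 mulr0 subr0.
rewrite big_nat_recr //=.
have := IH (ltnW nT); have := @round_regret n.+1 nT; lra.
Qed.

End Run.

(** * The final regret bound *)

Theorem theorem5 (R : realType) (d T : nat) (G eps k : R)
    (ell ellhat : nat -> 'rV[R]_d -> R) (x w g h : nat -> 'rV[R]_d)
    (G_gt0 : 0 < G) (eps_gt0 : 0 < eps) (k_ge3 : 3 <= k)
    (ell_convex : forall t, (1 <= t <= T)%N ->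
       convex_function (setT : set 'rV[R]_d) (ell t))
    (ell_lipschitz : forall t, (1 <= t <= T)%N -> elipschitz G (ell t))
    (ellhat_convex : forall t, (1 <= t <= T)%N ->
       convex_function (setT : set 'rV[R]_d) (ellhat t))
    (ellhat_lipschitz : forall t, (1 <= t <= T)%N -> elipschitz G (ellhat t))
    (run : iocmd T ell ellhat (regularizer k eps G g h) x w g h)
    (u : 'rV[R]_d) :
  \sum_(1 <= t < T.+1) (ell t (w t) - ell t u) <=
    4 * eps * G
    + 2 * k * enorm u *
      Num.max
        (Num.sqrt (Vhat G g h T.+1
                   * ln (enorm u / alphahat eps G g h T.+1 + 1)))
        (2 * G * ln (enorm u / alphahat eps G g h T.+1 + 1)).
Proof.
set Fu := Num.max _ _.
have V_gt0 := Vhat_gt0 g h G_gt0 T.+1.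
have al_gt0 := alphahat_gt0 g h G_gt0 eps_gt0 T.+1.
have n_ge0 := enorm_ge0 u.
have eG_ge0 : 0 <= 4 * eps * G by rewrite !mulr_ge0 // ltW.
have k_ge0 : 0 <= k by apply: le_trans k_ge3.
have linearized : \sum_(1 <= t < T.+1) (ell t (w t) - ell t u) <=
    \sum_(1 <= t < T.+1) dotp (g t) (w t) - dotp (grad_sum g T.+1) u.
  have -> : dotp (grad_sum g T.+1) u = \sum_(1 <= t < T.+1) dotp (g t) u.
    rewrite /grad_sum; elim/big_ind2: _ => //; first exact: dotp0l.
    by move=> ? ? ? ? <- <-; rewrite dotpDl.
  rewrite -sumrB; apply: ler_sum_nat => t tT.
  have := iocmd_subgrad run tT u; rewrite dotpDr dotpNr; lra.
have := leader_regret G_gt0 eps_gt0 k_ge3 ell_lipschitz ellhat_lipschitz run (leqnn T).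
(* The comparator [u] enters through the minimality of the last leader [x T.+1]. *)
have := iocmd_leader G_gt0 eps_gt0 k_ge3 run (t := T.+1) (leqnn _) u.
have l1 := ln_Vhat_ge2 g h G_gt0 1; have lT := ln_Vhat_ge2 g h G_gt0 T.+1.
have : 4 * eps * G * (2 / ln (Vhat G g h 1 / G ^+ 2) - 2 / ln (Vhat G g h T.+1 / G ^+ 2))
    <= 4 * eps * G.
  rewrite ler_piMr // lerBlDr.
  (* The leftovers add up to at most [4 * eps * G] because the first logarithm is at least [2]. *)
  have : 2 / ln (Vhat G g h 1 / G ^+ 2) <= 1 by rewrite ler_pdivrMr ?mul1r //; lra.
  have : 0 <= 2 / ln (Vhat G g h T.+1 / G ^+ 2) by rewrite divr_ge0 //; lra.
  lra.
have Fle := reg_slope_le_max G_gt0 V_gt0 al_gt0 n_ge0.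
(* Convexity towards [0] bounds the profile at [enorm u] by [enorm u] times its slope there. *)
have := radial_bregman_ge0 G_gt0 V_gt0 al_gt0 n_ge0 (lexx 0).
rewrite radial0 => radial_le.
have : k * radial G (Vhat G g h T.+1) (alphahat eps G g h T.+1) (enorm u) <=
    k * (enorm u * (2 * Fu)).
  by rewrite ler_wpM2l //; have := ler_wpM2l n_ge0 Fle; rewrite /Fu /log_radius; lra.
rewrite -regularizerE /leader_value.
move: (regularizer _ _ _ _ _ _ (x _)) (regularizer _ _ _ _ _ _ u) => px pu; lra.
Qed.
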